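(* Let $(M,\varphi,\pi)$ be a Hom-Poisson manifold, where $\varphi:M\to M$ is a diffeomorphism. Then $(\varphi^!TM,\varphi^!_\pi T^*M)$ is a Hom-Lie bialgebroid, where $\varphi^!TM$ carries the Hom-Lie algebroid structure $(\varphi^!TM,\varphi,\mathrm{Ad}_{\varphi^*},[\cdot,\cdot]_{\varphi^*},\mathrm{id})$ and $\varphi^!_\pi T^*M$ denotes the cotangent Hom-Lie algebroid $(\varphi^!T^*M,\varphi,\mathrm{Ad}^\dagger_{\varphi^*},[\cdot,\cdot]_{\pi^\sharp},\pi^\sharp)$ associated to $(M,\varphi,\pi)$.
   Context: Manifolds, bundles and maps are smooth; functions are real-valued. A Hom-Lie algebra $(\mathfrak g,[\cdot,\cdot],\phi)$ is a vector space with a skew-symmetric bilinear bracket and a linear map $\phi$ such that $\phi[x,y]=[\phi(x),\phi(y)]$ and $[\phi(x),[y,z]]+[\phi(y),[z,x]]+[\phi(z),[x,y]]=0$. A representation of it on $V$ with respect to $\beta\in\mathfrak{gl}(V)$ is a linear map $\rho:\mathfrak g\to\mathfrak{gl}(V)$ with $\rho(\phi(x))\circ\beta=\beta\circ\rho(x)$ and $\rho([x,y])\circ\beta=\rho(\phi(x))\circ\rho(y)-\rho(\phi(y))\circ\rho(x)$. $\varphi^*f=f\circ\varphi$. A Hom-bundle $(A\to M,\varphi,\phi_A)$ is a vector bundle with a smooth map $\varphi:M\to M$ and a linear map $\phi_A:\Gamma(A)\to\Gamma(A)$ such that $\phi_A(fx)=\varphi^*(f)\phi_A(x)$; it is invertible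 if $\varphi$ is a diffeomorphism and $\phi_A$ is invertible. $\phi_A$ extends to $\Gamma(\wedge^kA)$ by $\phi_A(x_1\wedge\cdots\wedge x_k)=\phi_A(x_1)\wedge\cdots\wedge\phi_A(x_k)$. For an invertible Hom-bundle, $(\phi_A^\dagger(\Xi))(X)=\varphi^*\big(\Xi(\phi_A^{-1}(X))\big)$ for $\Xi\in\Gamma(\wedge^kA^* )$, $X\in\Gamma(\wedge^kA)$. $\varphi^!TM$ is the pullback bundle of $TM$; a section $x$ acts on functions by $x(f)(m)=x_m(f)$, where $x_m\in T_{\varphi(m)}M$; for a diffeomorphism $\varphi$, $\Gamma(\varphi^!TM)$ is identified with linear maps $x$ on $C^\infty(M)$ with $x(fg)=x(f)\varphi^*(g)+\varphi^*(f)x(g)$. A Hom-Lie algebroid $(A,\varphi,\phi_A,[\cdot,\cdot]_A,a_A)$ is a Hom-bundle with a Hom-Lie algebra structure $(\Gamma(A),[\cdot,\cdot]_A,\phi_A)$ and a bundle map $a_A:A\to\varphi^!TM$ such that $[x,fy]_A=\varphi^*(f)[x,y]_A+a_A(\phi_A(x))(f)\phi_A(y)$ and $a_A$ is a representation of $(\Gamma(A),[\cdot,\cdot]_A,\phi_A)$ on $C^\infty(M)$ with respect to $\varphi^*$. Its differential operator (underlying Hom-bundle invertible) is $$(\mathrm{d}\Xi)(x_1,\dots,x_{k+1})=\sum_i(-1)^{i+1}a_A(x_i)\Xi(\phi_A^{-1}(x_1),\dots,\widehat{\phi_A^{-1}(x_i)},\dots,\phi_A^{-1}(x_{k+1}))+\sum_{i<j}(-1)^{i+j}\phi_A^\dagger(\Xi)([\phi_A^{-1}(x_i),\phi_A^{-1}(x_j)]_A,x_1,\dots,\widehat{x_i},\dots,\widehat{x_j},\dots,x_{k+1}).$$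 Its Hom-Schouten bracket is, for $p,q\ge1$, $\llbracket x_1\wedge\cdots\wedge x_p,y_1\wedge\cdots\wedge y_q\rrbracket_A=\sum_{i,j}(-1)^{i+j}[x_i,y_j]_A\wedge\phi_A(x_1\wedge\cdots\widehat{x_i}\cdots\wedge x_p\wedge y_1\wedge\cdots\widehat{y_j}\cdots\wedge y_q)$. Its Lie derivative on $\xi\in\Gamma(A^* )$ is $\langle L_x\xi,y\rangle=a_A(\phi_A(x))\langle\xi,\phi_A^{-1}(y)\rangle-\langle\phi_A^\dagger(\xi),[x,\phi_A^{-1}(y)]_A\rangle$. Hom-Lie bialgebroid: let $(A,\varphi,\phi_A)$ be an invertible Hom-bundle and $(A,\varphi,\phi_A,[\cdot,\cdot]_A,a_A)$, $(A^*,\varphi,\phi_A^\dagger,[\cdot,\cdot]_{A^*},a_{A^*})$ two Hom-Lie algebroids in duality. $(A,A^* )$ is a Hom-Lie bialgebroid if $\mathrm{d}_*[x,y]_A=\llbracket\mathrm{d}_*x,\phi_A(y)\rrbracket_A+\llbracket\phi_A(x),\mathrm{d}_*y\rrbracket_A$ for all $x,y\in\Gamma(A)$, where $\mathrm{d}_*:\Gamma(\wedge^kA)\to\Gamma(\wedge^{k+1}A)$ is the differential operator of the Hom-Lie algebroid $A^*$. The structures in the claim: $\mathrm{Ad}_{\varphi^*}(x)=\varphi^*\circ x\circ(\varphi^* )^{-1}$ and $[x,y]_{\varphi^*}=\varphi^*\circ x\circ(\varphi^* )^{-1}\circ y\circ(\varphi^* )^{-1}-\varphi^*\circ y\circ(\varphi^*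 )^{-1}\circ x\circ(\varphi^* )^{-1}$. A Hom-Poisson manifold $(M,\varphi,\pi)$ has $\pi\in\Gamma(\wedge^2\varphi^!TM)$ with $\llbracket\pi,\pi\rrbracket_{\varphi^!TM}=0$ and $\mathrm{Ad}_{\varphi^*}(\pi)=\pi$. The map $\mathrm{Ad}^\dagger_{\varphi^*}$ is $\phi_A^\dagger$ for $\phi_A=\mathrm{Ad}_{\varphi^*}$, $\pi^\sharp:\varphi^!T^*M\to\varphi^!TM$ is $\pi^\sharp(\xi)(\eta)=\pi(\xi,\eta)$, and $[\xi,\eta]_{\pi^\sharp}=L_{\pi^\sharp(\xi)}\eta-L_{\pi^\sharp(\eta)}\xi-\mathrm{d}\,\pi(\xi,\eta)$ with $L,\mathrm{d}$ those of $\varphi^!TM$; $(\varphi^!T^*M,\varphi,\mathrm{Ad}^\dagger_{\varphi^*},[\cdot,\cdot]_{\pi^\sharp},\pi^\sharp)$ is a Hom-Lie algebroid. *)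

(* Defs.v *)
From HB Require Import structures.
From mathcomp Require Import all_boot all_order all_algebra.
From mathcomp Require Import all_classical all_reals all_analysis.
From mathcomp Require Import ring.

Set Implicit Arguments.
Unset Strict Implicit.
Unset Printing Implicit Defensive.

Import Order.TTheory GRing.Theory Num.Theory.
Import numFieldNormedType.Exports.
Local Open Scope classical_set_scope.
Local Open Scope ring_scope.

Section Ck.
Variable R : realType.

(* Only meaningful for an open [U], where it is the usual class C^k. *)
Fixpoint Ck (k : nat) (V W : normedModType R) (U : set V) (f : V -> W) : Prop :=
  if k is k'.+1 then
    (forall x, U x -> differentiable f x) /\ forall v, Ck k' U ('D_v f)
  else forall x, U x -> {for x, continuous f}.

Definition Cinf (V W : normedModType R) (U : set V) (f : V -> W) :=
  forall k, Ck k U f.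

Lemma near_differentiable (V W : normedModType R) (f g : V -> W) x :
  {near x, f =1 g} -> differentiable f x -> differentiable g x.
Proof.
move=> nfg df; have [dc /eqaddoP dE] := iffLR (diff_locallyP _ _) df.
have gE : g \o shift x = cst (g x) + 'd f x +o_ 0 id.
  apply/eqaddoP => e e0; have := dE _ e0.
  rewrite -(nbhs_singleton nfg).
  have nfg0 : \forall h \near 0, f (h + x) = g (h + x).
    by move: nfg; rewrite /prop_near1 => /nbhs0P; apply: filterS => h; rewrite addrC.
  apply: filterS2 nfg0 => h /=; rewrite !fctE /= => ->.
  by [].
by apply/diff_locallyP; rewrite (diff_unique dc gE).
Qed.

Lemma open_near (V : topologicalType) (W : Type) (U : set V) (f g : V -> W) x :
  open U -> U x -> (forall x, U x -> f x = g x) -> {near x, f =1 g}.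
Proof. by move=> oU Ux fg; apply: filterS (open_nbhs_nbhs (conj oU Ux)). Qed.

Section Closure.
Variable V : normedModType R.
Implicit Types (U : set V).

Lemma Ck_ext k (W : normedModType R) U (f g : V -> W) :
  open U -> (forall x, U x -> f x = g x) -> Ck k U f -> Ck k U g.
Proof.
move=> oU; elim: k f g => [|k IH] f g fg /=.
  move=> fc x Ux; rewrite /prop_for /continuous_at -(fg _ Ux).
  by apply: cvg_trans (fc x Ux); apply: near_eq_cvg; apply: open_near fg.
case=> df Df; split=> [x Ux|v].
  by apply: near_differentiable (df _ Ux); apply: open_near fg.
apply: (IH ('D_v f)) => // x Ux.
by apply: near_eq_derive; apply: open_near fg.
Qed.

Lemma Ck_sub k (W : normedModType R) U U' (f : V -> W) :
  U' `<=` U -> Ck k U f -> Ck k U' f.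
Proof.
move=> sU; elim: k f => [|k IH] f /=; first by move=> fc x /sU; exact: fc.
by case=> df Df; split=> [x /sU|v]; [exact: df | exact: IH].
Qed.

Lemma Ck_pred k (W : normedModType R) U (f : V -> W) :
  Ck k.+1 U f -> Ck k U f.
Proof.
elim: k f => [|k IH] f; first by case=> df _ x /df; exact: differentiable_continuous.
by case=> df Df; split=> // v; apply: IH; exact: Df.
Qed.

Lemma Ck_local k (W : normedModType R) U (f : V -> W) :
  (forall x, U x -> exists2 U', U' x & Ck k U' f) -> Ck k U f.
Proof.
elim: k f => [|k IH] f loc /=; first by move=> x /loc[U' U'x fc]; exact: fc.
split=> [x /loc[U' U'x [dU' _]]|v]; first exact: dU'.
by apply: IH => x /loc[U' U'x [_ DU']]; exists U' => //; exact: DU'.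
Qed.

Lemma Ck_cst k (W : normedModType R) U (c : W) : Ck k U (cst c : V -> W).
Proof.
elim: k c => [|k IH] c /=; first by move=> x _; exact: cst_continuous.
split=> // v; rewrite (_ : 'D_v _ = cst 0) //.
by apply/funext => x; rewrite derive_cst.
Qed.

Lemma CkD k (W : normedModType R) U (f g : V -> W) :
  open U -> Ck k U f -> Ck k U g -> Ck k U (f + g).
Proof.
move=> oU; elim: k f g => [|k IH] f g /=.
  by move=> fc gc x Ux; apply: continuousD; [exact: fc|exact: gc].
case=> df Df [dg Dg]; split=> [x Ux|v].
  by apply: differentiableD; [exact: df|exact: dg].
apply: Ck_ext (IH _ _ (Df v) (Dg v)) => // x Ux.
by rewrite deriveD //; apply: diff_derivable; [exact: df|exact: dg].
Qed.

Lemma CkM k U (f g : V -> R) :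
  open U -> Ck k U f -> Ck k U g -> Ck k U (f * g).
Proof.
move=> oU; elim: k f g => [|k IH] f g /=.
  by move=> fc gc x Ux; apply: continuousM; [exact: fc|exact: gc].
move=> Hf Hg; have [df Df] := Hf; have [dg Dg] := Hg; split=> [x Ux|v].
  by apply: differentiableM; [exact: df|exact: dg].
apply: Ck_ext (CkD oU (IH _ _ (Ck_pred Hf) (Dg v)) (IH _ _ (Ck_pred Hg) (Df v))) => // x Ux.
by rewrite deriveM //; apply: diff_derivable; [exact: df|exact: dg].
Qed.

Lemma Ck_sum k (W : normedModType R) U m (f : 'I_m -> V -> W) :
  open U -> (forall i, Ck k U (f i)) -> Ck k U (\sum_i f i).
Proof.
move=> oU; elim: m f => [|m IH] f fk.
  by rewrite big_ord0; exact: Ck_cst.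
by rewrite big_ord_recl; apply: CkD => //; exact: IH.
Qed.
End Closure.

Lemma Ck_coord k n m U (f : 'rV[R]_n -> 'rV[R]_m) (i : 'I_m) :
  open U -> Ck k U f -> Ck k U (fun x => f x ord0 i).
Proof.
move=> oU; elim: k f => [|k IH] f /=.
  move=> fc x Ux; apply: (@continuous_comp _ _ _ f (fun M : 'rV[R]_m => M ord0 i)).
    exact: fc.
  exact: coord_continuous.
case=> df Df; split=> [x Ux|v].
  apply: (@differentiable_comp _ _ _ _ f (fun M : 'rV[R]_m => M ord0 i)).
    exact: df.
  exact: differentiable_coord.
apply: Ck_ext (IH _ (Df v)) => // x Ux.
rewrite derive_mx ?mxE //; exact/diff_derivable/df.
Qed.

Lemma Ck_comp k n m (W : set 'rV[R]_n) (W' : set 'rV[R]_m)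
    (f : 'rV[R]_m -> R) (g : 'rV[R]_n -> 'rV[R]_m) :
  open W -> (forall x, W x -> W' (g x)) ->
  Ck k W' f -> Ck k W g -> Ck k W (f \o g).
Proof.
move=> oW gW; elim: k f => [|k IH] f.
  move=> fc gc x Wx; apply: continuous_comp; first exact: gc.
  exact/fc/gW.
move=> Hf Hg; have [df Df] := Hf; have [dg Dg] := Hg; split=> [x Wx|v].
  by apply: differentiable_comp; [exact: dg | exact/df/gW].
have Hk : Ck k W (\sum_(i < m) (fun x => 'D_v g x ord0 i)
                    * ('D_(delta_mx ord0 i) f \o g)).
  apply: Ck_sum => // i; apply: CkM => //; first exact: Ck_coord oW (Dg v).
  by apply: IH (Ck_pred Hg); exact: Df.
apply: Ck_ext Hk => // x Wx.
have dgx := dg _ Wx; have dfgx := df _ (gW _ Wx).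
have -> : 'D_v (f \o g) x = 'd f (g x) ('D_v g x).
  rewrite deriveE; last exact: differentiable_comp.
  by rewrite diff_comp //= deriveE.
rewrite fct_sumE [in RHS](row_sum_delta ('D_v g x)) linear_sum /=.
apply: eq_bigr => i _; rewrite linearZ /= !fctE /= [X in _ * X]deriveE //.
Qed.
End Ck.

(* A chart of a topological space modelled on R^n: a homeomorphism between an
   open set [cdom] and an open set [cimg] of R^n.  The values of [cfun] outside
   [cdom] and of [cinv] outside [cimg] are irrelevant. *)
Record chart (R : realType) (n : nat) (T : topologicalType) := Chart {
  cdom : set T;
  cimg : set 'rV[R]_n;
  cfun :> T -> 'rV[R]_n;
  cinv : 'rV[R]_n -> T;
  cdom_open : open cdom;
  cimg_open : open cimg;
  cfun_img : forall p, cdom p -> cimg (cfun p);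
  cinv_dom : forall u, cimg u -> cdom (cinv u);
  cfunK : forall p, cdom p -> cinv (cfun p) = p;
  cinvK : forall u, cimg u -> cfun (cinv u) = u;
  cfun_continuous : forall p, cdom p -> {for p, continuous cfun};
  cinv_continuous : forall u, cimg u -> {for u, continuous cinv} }.
Arguments cdom_open {R n T} c.
Arguments cimg_open {R n T} c.
Arguments cfun_continuous {R n T} c.
Arguments cinv_continuous {R n T} c.

Record manifold (R : realType) (n : nat) := Manifold {
  carrier :> topologicalType;
  carrier_hausdorff : hausdorff_space carrier;
  carrier_second_countable : @second_countable carrier;
  atlas : set (chart R n carrier);
  atlas_cover : forall p, exists2 c, atlas c & cdom c p;
  atlas_smooth : forall c c', atlas c -> atlas c' ->
    Cinf (cimg c `&` cinv c @^-1` cdom c') (c' \o cinv c) }.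

Section SmoothFunctions.
Variables (R : realType) (n : nat) (M : manifold R n).

Definition smooth (f : M -> R) :=
  forall c, atlas c -> Cinf (cimg c) (f \o cinv c).

Definition smooth_pred : {pred (M -> R)} := [pred f | `[< smooth f >]].

Fact smooth_subring : subring_closed smooth_pred.
Proof.
split=> [|f g /asboolP fs /asboolP gs|f g /asboolP fs /asboolP gs].
- by apply/asboolP => c _ k; exact: Ck_cst.
- apply/asboolP => c cM k; have oc := cimg_open c.
  rewrite (_ : _ \o _ = f \o cinv c + cst (-1) * (g \o cinv c)); last first.
    by apply/funext => u; rewrite !fctE /= mulN1r.
  by apply: CkD => //; [exact: fs | apply: CkM => //; [exact: Ck_cst | exact: gs]].
- apply/asboolP => c cM k; have oc := cimg_open c.
  by apply: CkM => //; [exact: fs | exact: gs].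
Qed.
HB.instance Definition _ :=
  GRing.isSubringClosed.Build (M -> R) smooth_pred smooth_subring.

Record Cinfty := SmoothFun {
  smooth_val :> M -> R;
  smooth_valP : smooth_val \in smooth_pred }.

HB.instance Definition _ := [isSub for smooth_val].
HB.instance Definition _ := [Choice of Cinfty by <:].
HB.instance Definition _ := GRing.SubChoice_isSubComPzRing.Build (M -> R) smooth_pred Cinfty smooth_subring.

Fact smooth_cst (r : R) : cst r \in smooth_pred.
Proof. by apply/asboolP => c _ k; exact: Ck_cst. Qed.
Definition Cst (r : R) : Cinfty := SmoothFun (smooth_cst r).

End SmoothFunctions.

Definition smooth_map (R : realType) (m n : nat) (M : manifold R m)
    (N : manifold R n) (phi : M -> N) :=
  continuous phi /\
  forall (c : chart R m M) (c' : chart R n N), atlas c -> atlas c' ->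
    Cinf (cimg c `&` (phi \o cinv c) @^-1` cdom c') (c' \o phi \o cinv c).

Record diffeo (R : realType) (n : nat) (M : manifold R n) := Diffeo {
  dfun :> M -> M;
  dinv : M -> M;
  dfun_smooth : smooth_map dfun;
  dinv_smooth : smooth_map dinv;
  dfunK : cancel dfun dinv;
  dinvK : cancel dinv dfun }.

Section Pullback.
Variables (R : realType) (m n : nat) (M : manifold R m) (N : manifold R n).

Fact smooth_comp (phi : M -> N) (f : Cinfty N) :
  smooth_map phi -> (f \o phi) \in @smooth_pred _ _ M.
Proof.
case=> cphi phiS; apply/asboolP => c cM k; apply: Ck_local => u cu.
have /asboolP fS := smooth_valP f.
have [c' c'N c'u] := atlas_cover (phi (cinv c u)).
have oW : open (cimg c `&` (phi \o cinv c) @^-1` cdom c').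
  rewrite openE => x [cx /= c'x]; apply: filterI.
    exact: (open_nbhs_nbhs (conj (cimg_open c) cx)).
  apply: (@continuous_comp _ _ _ (cinv c) phi x (cinv_continuous c _ cx) (cphi _)).
  exact: (open_nbhs_nbhs (conj (cdom_open c') c'x)).
exists (cimg c `&` (phi \o cinv c) @^-1` cdom c'); first by split.
apply: (Ck_ext (f := (f \o cinv c') \o (c' \o phi \o cinv c))) => //.
  by move=> x [cx /= c'x]; rewrite /= cfunK.
by apply: (Ck_comp oW _ (fS _ c'N k) (phiS _ _ cM c'N k)) => x [_ /=] /cfun_img.
Qed.
End Pullback.

Section PullbackDiffeo.
Variables (R : realType) (n : nat) (M : manifold R n).
Local Notation C := (Cinfty M).

Definition diffeo_inv (phi : diffeo M) : diffeo M :=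
  Diffeo (dinv_smooth phi) (dfun_smooth phi) (@dinvK _ _ _ phi) (@dfunK _ _ _ phi).

Definition pull (phi : diffeo M) (f : C) : C :=
  SmoothFun (smooth_comp f (dfun_smooth phi)).

Variable phi : diffeo M.

Fact pull_is_zmod_morphism : zmod_morphism (pull phi).
Proof. by move=> f g; exact: val_inj. Qed.
HB.instance Definition _ := GRing.isZmodMorphism.Build C C (pull phi) pull_is_zmod_morphism.
Fact pull_is_monoid_morphism : monoid_morphism (pull phi).
Proof. by split=> [|f g]; exact: val_inj. Qed.
HB.instance Definition _ := GRing.isMonoidMorphism.Build C C (pull phi) pull_is_monoid_morphism.

Lemma pull_Cst (r : R) : pull phi (Cst M r) = Cst M r.
Proof. exact: val_inj. Qed.

Lemma pullK : cancel (pull phi) (pull (diffeo_inv phi)).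
Proof. by move=> f; apply/val_inj/funext => p; rewrite /= dinvK. Qed.

Lemma pullVK : cancel (pull (diffeo_inv phi)) (pull phi).
Proof. by move=> f; apply/val_inj/funext => p; rewrite /= dfunK. Qed.

End PullbackDiffeo.

Section Sections.
Variables (R : realType) (n : nat) (M : manifold R n).
Local Notation C := (Cinfty M).

(* C^oo(M)-modules are real vector spaces through the constant functions. *)
Definition Rlinear (E F : lmodType C) (h : E -> F) :=
  forall (r : R) x y, h (Cst M r *: x + y) = Cst M r *: h x + h y.

Section Dual.
Variable E : lmodType C.

Definition dual_pred : {pred (E -> C^o)} :=
  [pred xi | `[< forall f x y, xi (f *: x + y) = f * xi x + xi y >]].

Fact dual_submod : submod_closed dual_pred.
Proof.
split=> [|f xi eta /asboolP xil /asboolP etal]; apply/asboolP => g x y.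
  by rewrite -[LHS]/(0 : C) -![(0 : E -> C^o) _]/(0 : C) mulr0 addr0.
by rewrite !fctE xil etal -![_ *: _ : C^o]/(_ * _ : C); ring.
Qed.

(* When [E] is the module of sections of a vector bundle A, this is the module
   of sections of A^*. *)
Record dual := Dual { dual_val :> E -> C; dual_valP : dual_val \in dual_pred }.

HB.instance Definition _ := [isSub for dual_val].
HB.instance Definition _ := [Choice of dual by <:].
HB.instance Definition _ :=
  GRing.SubChoice_isSubLmodule.Build C (E -> C^o) dual_pred dual dual_submod.

End Dual.

Section TwistedDerivations.
Variable phi : diffeo M.

Definition vfield_pred : {pred (C -> C^o)} := [pred x |
  `[< Rlinear (x : C^o -> C^o) /\
      forall f g, x (f * g) = x f * pull phi g + pull phi f * x g >]].

Fact vfield_submod : submod_closed vfield_pred.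
Proof.
split=> [|f x y /asboolP[xl xM] /asboolP[yl yM]]; apply/asboolP.
  split=> [r g h|g h]; rewrite -[LHS]/(0 : C) -![(0 : C -> C^o) _]/(0 : C).
    by rewrite scaler0 addr0.
  by rewrite mul0r mulr0 addr0.
split=> [r g h|g h]; rewrite !fctE.
  by rewrite xl yl /GRing.scale /=; ring.
by rewrite xM yM /GRing.scale /=; ring.
Qed.

(* Sections of phi^! TM, as operators on functions: x(f)(m) = x_m(f), where
   x_m is a tangent vector at phi(m). *)
Record vfield := VField {
  vfield_val :> C -> C;
  vfield_valP : vfield_val \in vfield_pred }.

HB.instance Definition _ := [isSub for vfield_val].
HB.instance Definition _ := [Choice of vfield by <:].
HB.instance Definition _ :=
  GRing.SubChoice_isSubLmodule.Build C (C -> C^o) vfield_pred vfield vfield_submod.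

End TwistedDerivations.
End Sections.

Arguments dual_valP {R n M E} d.
Arguments vfield_valP {R n M phi} v.

Section DualTheory.
Variables (R : realType) (n : nat) (M : manifold R n).
Local Notation C := (Cinfty M).

Lemma dualP (E : lmodType C) (xi : dual E) f x y :
  xi (f *: x + y) = f * xi x + xi y.
Proof. by have /asboolP := dual_valP xi; apply. Qed.

Fact dual_is_linear (E : lmodType C) (xi : dual E) :
  linear (xi : E -> C^o).
Proof. exact: dualP. Qed.
HB.instance Definition _ (E : lmodType C) (xi : dual E) :=
  GRing.isLinear.Build C E C^o *:%R (dual_val xi : E -> C^o) (dual_is_linear xi).

Lemma dualZB (E : lmodType C) (xi : dual E) f g x y :
  xi (f *: x - g *: y) = f * xi x - g * xi y.
Proof.
rewrite -scaleNr addrC dualP -[f *: x]addr0 dualP (linear0 xi) addr0 addrC.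
by rewrite mulNr.
Qed.

Lemma dual_sum (E : lmodType C) (xi : dual E) r (x : 'I_r -> E) :
  xi (\sum_s x s) = \sum_s xi (x s).
Proof. exact: (linear_sum xi). Qed.

Variable phi : diffeo M.

Lemma vfieldP (x : vfield phi) r f g :
  x (Cst M r * f + g) = Cst M r * x f + x g.
Proof. by have /asboolP[+ _] := vfield_valP x; apply. Qed.

Lemma vfieldM (x : vfield phi) f g :
  x (f * g) = x f * pull phi g + pull phi f * x g.
Proof. by have /asboolP[_ +] := vfield_valP x; apply. Qed.

Fact vfield_is_zmod_morphism (x : vfield phi) : zmod_morphism x.
Proof.
move=> f g; have -> : f - g = Cst M (-1) * g + f.
  rewrite addrC; congr (_ + _); apply: val_inj; apply/funext => p.
  by rewrite /= !fctE mulN1r.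
rewrite vfieldP addrC; congr (_ + _); apply: val_inj; apply/funext => p.
by rewrite /= !fctE mulN1r.
Qed.
HB.instance Definition _ (x : vfield phi) :=
  GRing.isZmodMorphism.Build C C x (vfield_is_zmod_morphism x).

End DualTheory.

Section HomBundles.
Variables (R : realType) (n : nat) (M : manifold R n) (phi : diffeo M).
Local Notation C := (Cinfty M).

(* An invertible Hom-bundle over the diffeomorphism phi.  The vector bundle is
   given by its C^oo(M)-module of sections; no projectivity is asked of it,
   the only bundles considered below being phi^! TM and its dual.
   R-linearity of [hb_map] is a consequence of the last two axioms. *)
Record hom_bundle := HomBundle {
  hb_sec :> lmodType C;
  hb_map : hb_sec -> hb_sec;
  hb_inv : hb_sec -> hb_sec;
  hb_mapK : cancel hb_map hb_inv;
  hb_invK : cancel hb_inv hb_map;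
  hb_mapD : forall x y, hb_map (x + y) = hb_map x + hb_map y;
  hb_mapZ : forall f x, hb_map (f *: x) = pull phi f *: hb_map x }.

Lemma hb_invD (A : hom_bundle) (x y : A) : hb_inv (x + y) = hb_inv x + hb_inv y.
Proof. by apply: (can_inj (@hb_mapK A)); rewrite hb_mapD !hb_invK. Qed.

Lemma hb_invZ (A : hom_bundle) f (x : A) :
  hb_inv (f *: x) = pull (diffeo_inv phi) f *: hb_inv x.
Proof. by apply: (can_inj (@hb_mapK A)); rewrite hb_mapZ !hb_invK pullVK. Qed.

Definition dagger_form (A : hom_bundle) k (Xi : ('I_k -> A) -> C)
  (X : 'I_k -> A) : C := pull phi (Xi (@hb_inv A \o X)).

Fact dagger_subproof (A : hom_bundle) (xi : dual A) :
  (fun x : A => pull phi (xi (hb_inv x))) \in @dual_pred _ _ _ A.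
Proof.
by apply/asboolP => f x y; rewrite hb_invD hb_invZ dualP rmorphD rmorphM /= pullVK.
Qed.
Definition dagger (A : hom_bundle) (xi : dual A) : dual A :=
  Dual (dagger_subproof xi).

Fact dagger_inv_subproof (A : hom_bundle) (xi : dual A) :
  (fun x : A => pull (diffeo_inv phi) (xi (hb_map x))) \in @dual_pred _ _ _ A.
Proof.
by apply/asboolP => f x y; rewrite hb_mapD hb_mapZ dualP rmorphD rmorphM /= pullK.
Qed.
Definition dagger_inv (A : hom_bundle) (xi : dual A) : dual A :=
  Dual (dagger_inv_subproof xi).

Section DualBundle.
Variable A : hom_bundle.

Fact daggerK : cancel (@dagger A) (@dagger_inv A).
Proof. by move=> xi; apply/val_inj/funext => x; rewrite /= hb_mapK pullK. Qed.
Fact dagger_invK : cancel (@dagger_inv A) (@dagger A).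
Proof. by move=> xi; apply/val_inj/funext => x; rewrite /= hb_invK pullVK. Qed.
Fact daggerD (xi eta : dual A) : dagger (xi + eta) = dagger xi + dagger eta.
Proof. by apply/val_inj/funext => x; rewrite /= !fctE rmorphD. Qed.
Fact daggerZ f (xi : dual A) : dagger (f *: xi) = pull phi f *: dagger xi.
Proof. by apply/val_inj/funext => x; exact: rmorphM. Qed.

Definition dual_bundle := HomBundle daggerK dagger_invK daggerD daggerZ.
End DualBundle.

Section HomLie.

(* Hom-Lie algebras and their representations are real vector spaces; here
   these spaces are C^oo(M)-modules with scalars restricted to R. *)
Definition hom_lie_algebra (g : lmodType C) (br : g -> g -> g) (al : g -> g) :=
  [/\ forall x, Rlinear (br x),
      forall x y, br x y = - br y x,
      Rlinear al,
      forall x y, al (br x y) = br (al x) (al y) &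
      forall x y z,
        br (al x) (br y z) + br (al y) (br z x) + br (al z) (br x y) = 0].

Definition hom_lie_rep (g : lmodType C) (br : g -> g -> g) (al : g -> g)
    (V : lmodType C) (beta : V -> V) (rho : g -> V -> V) :=
  [/\ forall v, Rlinear (rho ^~ v),
      forall x, Rlinear (rho x),
      Rlinear beta,
      forall x v, rho (al x) (beta v) = beta (rho x v) &
      forall x y v, rho (br x y) (beta v)
        = rho (al x) (rho y v) - rho (al y) (rho x v)].

End HomLie.

Section Algebroid.
Variables (A : hom_bundle) (br : A -> A -> A) (a : A -> vfield phi).

Definition hom_lie_algebroid :=
  [/\ hom_lie_algebra br (@hb_map A),
      forall f x y, a (f *: x + y) = f *: a x + a y,
      forall x y f, br x (f *: y)
        = pull phi f *: br x y + a (hb_map x) f *: hb_map y &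
      @hom_lie_rep A br (@hb_map A) C^o (pull phi) (fun x => a x)].

(* For [i < j], the entries of [x] with those of indices [i] and [j] removed,
   preceded by [z]. *)
Definition cons_omit2 k (z : A) (x : 'I_k.+1 -> A) (i j : 'I_k.+1)
  (l : 'I_k) : A := if val l is l'.+1 then x (inord (bump j (bump i l'))) else z.

(* Indices start at 0, whence [(-1) ^+ i] in place of (-1)^(i+1). *)
Definition differential k (Xi : ('I_k -> A) -> C) (x : 'I_k.+1 -> A) : C :=
  \sum_(i < k.+1) (-1) ^+ i *
      a (x i) (Xi (fun l => hb_inv (x (lift i l))))
  + \sum_(i < k.+1) \sum_(j < k.+1 | (i < j)%N) (-1) ^+ (i + j) *
      dagger_form Xi (cons_omit2 (br (hb_inv (x i)) (hb_inv (x j))) x i j).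

Definition lie_derivative (x : A) (xi : dual A) (y : A) : C :=
  a (hb_map x) (xi (hb_inv y)) - dagger xi (br x (hb_inv y)).

End Algebroid.

(* Sections of the k-th exterior power of A are identified with the alternating
   C^oo(M)-multilinear functions of k sections of A^*, with the convention
   <x_1 /\ ... /\ x_k, (xi_1, ..., xi_k)> = det <xi_i, x_j>. *)
Section Multivectors.
Variable A : hom_bundle.

Record multivector k := Multivector {
  mv_val :> ('I_k -> dual A) -> C;
  mv_multilinear : forall (X : 'I_k -> dual A) i f xi eta,
    mv_val [eta X with i |-> f *: xi + eta]
      = f * mv_val [eta X with i |-> xi] + mv_val [eta X with i |-> eta];
  mv_alternating : forall (X : 'I_k -> dual A) i j,
    i != j -> X i = X j -> mv_val X = 0 }.

Definition wedge_prod k (x : 'I_k -> A) (X : 'I_k -> dual A) : C :=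
  \det (\matrix_(i, j) X i (x j)).

Definition sum_wedge k r (x : 'I_r -> 'I_k -> A) (X : 'I_k -> dual A) : C :=
  \sum_s wedge_prod (x s) X.

(* Q = phi_A(P) *)
Definition map_multivector k (P Q : ('I_k -> dual A) -> C) :=
  exists r (x : 'I_r -> 'I_k -> A),
    P =1 sum_wedge x /\ Q =1 sum_wedge (fun s => @hb_map A \o x s).

Variable br : A -> A -> A.

(* [x_i, y_j] followed by the phi_A(x_l), l != i, and the phi_A(y_l), l != j *)
Definition schouten_term p q (x : 'I_p.+1 -> A) (y : 'I_q.+1 -> A)
    (i : 'I_p.+1) (j : 'I_q.+1) (l : 'I_(1 + (p + q))) : A :=
  match fintype.split l with
  | inl _ => br (x i) (y j)
  | inr l' => match fintype.split l' with
              | inl u => hb_map (x (lift i u))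
              | inr v => hb_map (y (lift j v))
              end
  end.

Definition schouten_wedge p q (x : 'I_p.+1 -> A) (y : 'I_q.+1 -> A)
    (X : 'I_(1 + (p + q)) -> dual A) : C :=
  \sum_(i < p.+1) \sum_(j < q.+1) (-1) ^+ (i + j) * wedge_prod (schouten_term x y i j) X.

(* S = [[P, Q]], for P and Q of degrees p+1 and q+1.  The bracket is the
   biadditive extension of its values on decomposable multivectors; every
   multivector is a finite sum of these, and S does not depend on the sums. *)
Definition schouten p q (P : ('I_p.+1 -> dual A) -> C)
    (Q : ('I_q.+1 -> dual A) -> C) (S : ('I_(1 + (p + q)) -> dual A) -> C) :=
  exists r (x : 'I_r -> 'I_p.+1 -> A) r' (y : 'I_r' -> 'I_q.+1 -> A),
    [/\ P =1 sum_wedge x, Q =1 sum_wedge y &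
        forall X, S X = \sum_s \sum_t schouten_wedge (x s) (y t) X].

(* a section of A, as a section of the first exterior power *)
Definition multivector1 (x : A) (X : 'I_1 -> dual A) : C := X ord0 x.

End Multivectors.

Section Bialgebroid.
Variables (A : hom_bundle) (br : A -> A -> A) (a : A -> vfield phi).
Variables (br' : dual A -> dual A -> dual A) (a' : dual A -> vfield phi).

Definition dstar k (P : ('I_k -> dual A) -> C) : ('I_k.+1 -> dual A) -> C :=
  @differential (dual_bundle A) br' a' k P.

Definition hom_lie_bialgebroid :=
  [/\ hom_lie_algebroid br a,
      @hom_lie_algebroid (dual_bundle A) br' a' &
      forall x y : A, exists S1 S2 : ('I_2 -> dual A) -> C,
        [/\ @schouten A br 1 0 (dstar (multivector1 x))
              (multivector1 (hb_map y)) S1,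
            @schouten A br 0 1 (multivector1 (hb_map x))
              (dstar (multivector1 y)) S2 &
            dstar (multivector1 (br x y)) =1 (fun X => S1 X + S2 X)]].

End Bialgebroid.
End HomBundles.

Lemma det_mx2 (K : comPzRingType) (A : 'M[K]_2) :
  \det A = A ord0 ord0 * A ord_max ord_max - A ord0 ord_max * A ord_max ord0.
Proof.
rewrite (expand_det_row _ ord0) big_ord_recl big_ord1 /cofactor !det_mx11 !mxE /=.
have -> : lift (lift ord0 ord0) ord0 = ord0 :> 'I_2 by apply/val_inj.
have -> : lift ord0 ord0 = ord_max :> 'I_2 by apply/val_inj.
by rewrite expr0 mul1r expr1 mulN1r mulrN.
Qed.

Section TangentBundle.
Variables (R : realType) (n : nat) (M : manifold R n) (phi : diffeo M).
Local Notation C := (Cinfty M).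
Local Notation ipull := (pull (diffeo_inv phi)).

Lemma pull_linear (psi : diffeo M) (r : R) (f g : C) :
  pull psi (Cst M r * f + g) = Cst M r * pull psi f + pull psi g.
Proof. by rewrite rmorphD rmorphM /= pull_Cst. Qed.

Lemma vfieldI (x : C -> C) :
  (forall r f g, x (Cst M r * f + g) = Cst M r * x f + x g) ->
  (forall f g, x (f * g) = x f * pull phi g + pull phi f * x g) ->
  x \in vfield_pred phi.
Proof. by move=> xl xM; apply/asboolP; split. Qed.

Fact Ad_vfield (x : vfield phi) :
  (fun f => pull phi (x (ipull f))) \in vfield_pred phi.
Proof.
apply: vfieldI => [r f g|f g].
  by rewrite !(pull_linear, vfieldP).
by rewrite rmorphM /= vfieldM !pullVK rmorphD !rmorphM.
Qed.
Definition Ad (x : vfield phi) : vfield phi := VField (Ad_vfield x).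

Fact Ad_inv_vfield (x : vfield phi) :
  (fun f => ipull (x (pull phi f))) \in vfield_pred phi.
Proof.
apply: vfieldI => [r f g|f g].
  by rewrite !(pull_linear, vfieldP).
by rewrite rmorphM /= vfieldM rmorphD !rmorphM /= !pullK.
Qed.
Definition Ad_inv (x : vfield phi) : vfield phi := VField (Ad_inv_vfield x).

Fact AdK : cancel Ad Ad_inv.
Proof. by move=> x; apply/val_inj/funext => f; rewrite /= !pullK. Qed.
Fact Ad_invK : cancel Ad_inv Ad.
Proof. by move=> x; apply/val_inj/funext => f; rewrite /= !pullVK. Qed.
Fact AdD x y : Ad (x + y) = Ad x + Ad y.
Proof. by apply/val_inj/funext => f; rewrite /= !fctE rmorphD. Qed.
Fact AdZ f x : Ad (f *: x) = pull phi f *: Ad x.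
Proof. by apply/val_inj/funext => g; exact: rmorphM. Qed.

Definition tangent : hom_bundle phi := HomBundle AdK Ad_invK AdD AdZ.

Fact tangent_bracket_vfield (x y : vfield phi) :
  (fun f => pull phi (x (ipull (y (ipull f))))
          - pull phi (y (ipull (x (ipull f))))) \in vfield_pred phi.
Proof.
apply: vfieldI => [r f g|f g].
  rewrite !(pull_linear, vfieldP); ring.
rewrite !(rmorphM, rmorphD, vfieldM, raddfD, pullVK) /=.
rewrite !(rmorphM, rmorphD, vfieldM, raddfD, pullVK) /=.
ring.
Qed.
Definition tangent_bracket (x y : tangent) : tangent :=
  VField (tangent_bracket_vfield x y).

Definition tangent_anchor (x : tangent) : vfield phi := x.

Local Notation d := (differential tangent_bracket tangent_anchor).

Lemma differential0 (f : C) (x : 'I_1 -> tangent) :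
  d (fun _ : 'I_0 -> tangent => f) x = x ord0 f.
Proof.
rewrite /differential [X in _ + X]big1 ?addr0; last first.
  by move=> i _; rewrite big1 // => j; rewrite !ord1 ltnn.
by rewrite big_ord_recl big_ord0 expr0 mul1r addr0.
Qed.

Fact exact_form_subproof (f : C) :
  (fun x : tangent => d (fun _ : 'I_0 -> tangent => f) (fun=> x))
    \in @dual_pred _ _ _ tangent.
Proof. by apply/asboolP => g x y; rewrite !differential0. Qed.
(* df, as a section of the dual bundle *)
Definition exact_form (f : C) : dual tangent := Dual (exact_form_subproof f).

Lemma exact_formE f x : exact_form f x = x f.
Proof. exact: differential0. Qed.

Lemma exact_formM f g : exact_form (f * g) = pull phi g *: exact_form f + pull phi f *: exact_form g.
Proof.
apply/val_inj/funext => x; rewrite -[LHS]/(exact_form (f * g) x).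
rewrite -[RHS]/(pull phi g * exact_form f x + pull phi f * exact_form g x) !exact_formE vfieldM.
by rewrite [X in X + _]mulrC.
Qed.

Lemma exact_form_Rlinear r f g : exact_form (Cst M r * f + g) = Cst M r *: exact_form f + exact_form g.
Proof.
apply/val_inj/funext => x; rewrite -[LHS]/(exact_form (Cst M r * f + g) x).
by rewrite -[RHS]/(Cst M r * exact_form f x + exact_form g x) !exact_formE vfieldP.
Qed.

Lemma tangent_bracketDr x y z :
  tangent_bracket x (y + z) = tangent_bracket x y + tangent_bracket x z.
Proof.
apply/val_inj/funext => g.
rewrite -[RHS]/(tangent_bracket x y g + tangent_bracket x z g) /=.
by rewrite !fctE !(rmorphD, raddfD) /= addrACA.
Qed.

Lemma tangent_bracketZr x f y :
  tangent_bracket x (f *: y) = pull phi f *: tangent_bracket x y + Ad x f *: Ad y.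
Proof.
apply/val_inj/funext => g.
rewrite -[RHS]/(pull phi f * tangent_bracket x y g + Ad x f * Ad y g) /=.
rewrite -![(f *: (y : C -> C^o)) _]/(f * y _).
by rewrite !(rmorphM, vfieldM, rmorphD, pullVK) /=; ring.
Qed.

Lemma vfieldD (x : vfield phi) f g : x (f + g) = x f + x g.
Proof. exact: raddfD. Qed.

Fact lie_derivative_subproof (x : tangent) (xi : dual tangent) :
  lie_derivative tangent_bracket tangent_anchor x xi \in @dual_pred _ _ _ tangent.
Proof.
apply/asboolP => f y z; rewrite /lie_derivative hb_invD hb_invZ dualP.
rewrite tangent_bracketDr tangent_bracketZr pullVK -addrA dualP.
rewrite -[Ad (hb_inv y)]/(hb_map (hb_inv y)) hb_invK dualP.
rewrite -![tangent_anchor _]/(Ad x) (vfieldD (Ad x)) (vfieldM (Ad x)) pullVK.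
rewrite -[dagger xi y]/(pull phi (xi (hb_inv y))).
suff aux (a p b q r s : C) :
  a * p + f * b + q - (f * r + (a * p + s)) = f * (b - r) + (q - s) by exact: aux.
by ring.
Qed.
Definition lie (x : tangent) (xi : dual tangent) : dual tangent :=
  Dual (lie_derivative_subproof x xi).

Definition pair2 (T : Type) (u v : T) (i : 'I_2) : T := if i == ord0 then u else v.

Variable pi : multivector tangent 2.

Lemma mv_pair2 (xi : dual tangent) f eta zeta :
  pi (pair2 xi (f *: eta + zeta)) = f * pi (pair2 xi eta) + pi (pair2 xi zeta).
Proof.
have E z : pair2 xi z = [eta pair2 xi 0 with ord_max |-> z].
  by apply/funext => i /=; rewrite /pair2; case: i => [[|[|i]] Hi].
by rewrite (E (f *: eta + zeta)) mv_multilinear -!E.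
Qed.

Fact sharp_subproof (xi : dual tangent) :
  (fun f => pi (pair2 xi (exact_form f))) \in vfield_pred phi.
Proof.
apply: vfieldI => [r f g|f g]; first by rewrite exact_form_Rlinear mv_pair2.
have mv0 : pi (pair2 xi 0) = 0.
  apply: (addrI (pi (pair2 xi 0))); have := mv_pair2 xi 1 0 0.
  by rewrite scale1r mul1r !addr0 => <-.
rewrite exact_formM mv_pair2 -[pull phi f *: exact_form g]addr0 mv_pair2 mv0 addr0.
by rewrite mulrC.
Qed.
(* pi^sharp(xi) is the section x of A with <eta, x> = pi(xi, eta) for all eta;
   its action on f is the case eta = df. *)
Definition sharp (xi : dual tangent) : vfield phi := VField (sharp_subproof xi).

Lemma sum_wedge2 r (x : 'I_r -> 'I_2 -> tangent) (xi eta : dual tangent) :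
  sum_wedge x (pair2 xi eta) =
  \sum_s (xi (x s ord0) * eta (x s ord_max) - xi (x s ord_max) * eta (x s ord0)).
Proof.
apply: eq_bigr => s _; by rewrite /wedge_prod det_mx2 !mxE.
Qed.

Lemma vfield_sum r (x : 'I_r -> tangent) (f : C) :
  (\sum_s x s : tangent) f = \sum_s x s f.
Proof.
by elim/big_rec2: _ => // s u v _ <-.
Qed.

Lemma vfieldZB (x y : tangent) (f g h : C) :
  (f *: x - g *: y : tangent) h = f * x h - g * y h.
Proof. by []. Qed.

Lemma sharpE r (x : 'I_r -> 'I_2 -> tangent) (xi eta : dual tangent) :
  pi =1 sum_wedge x -> eta (sharp xi) = pi (pair2 xi eta).
Proof.
move=> piE; have -> : sharp xi =
    \sum_s (xi (x s ord0) *: x s ord_max - xi (x s ord_max) *: x s ord0) :> tangent.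
  apply/val_inj/funext => f; rewrite [RHS]vfield_sum [LHS]/= piE sum_wedge2.
  by apply: eq_bigr => s _; rewrite vfieldZB !exact_formE.
rewrite piE sum_wedge2 dual_sum; apply: eq_bigr => s _.
exact: dualZB.
Qed.

Definition cotangent_bracket (xi eta : dual tangent) : dual tangent :=
  lie (sharp xi) eta - lie (sharp eta) xi - exact_form (pi (pair2 xi eta)).

Definition hom_poisson :=
  @schouten _ _ _ _ _ tangent_bracket 1 1 pi pi (fun=> 0) /\ map_multivector pi pi.

End TangentBundle.

(* Main.v *)
Require Import Defs.
From mathcomp Require Import all_boot all_order all_algebra.
From mathcomp Require Import all_classical all_reals all_analysis.
From mathcomp Require Import ring.

(* Since phi is invertible, composing a phi^*-twisted derivation with
   (phi^* )^-1 gives an ordinary derivation, and both brackets become the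
   images, under the structure maps Ad and Ad^dagger, of ordinary Lie brackets
   preserved by these maps: the commutator of derivations, and the Koszul
   bracket of pi, which is the bracket of the cotangent Lie algebroid of a
   Poisson structure.  The axioms of the latter follow from Cartan calculus once
   pi^sharp is known to preserve brackets, and the defect of that property is a
   multiple of the Schouten bracket of pi with itself.  Up to sign and twist,
   d_* x is the Lie derivative of pi along x, so that the compatibility
   condition says that L_[x, y] is the commutator of L_x and L_y on pi. *)

Set Implicit Arguments.
Unset Strict Implicit.
Unset Printing Implicit Defensive.

Import GRing.Theory Num.Theory.
Local Open Scope ring_scope.

(** * Derivations attached to sections of the twisted tangent bundle *)

Section Derivation.
Variables (R : realType) (n : nat) (M : manifold R n) (phi : diffeo M).
Local Notation C := (Cinfty M).
Local Notation sg := (pull phi).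
Local Notation sgV := (pull (diffeo_inv phi)).

(* The map [x |-> x \o (phi^* )^-1] identifies the twisted derivations with the
   derivations of [C]. *)
Definition derivation (x : vfield phi) (f : C) : C := x (sgV f).
Local Notation D := derivation.

Lemma derivationD x f g : D x (f + g) = D x f + D x g.
Proof. by rewrite /derivation !raddfD. Qed.

Lemma derivationB x f g : D x (f - g) = D x f - D x g.
Proof. by rewrite /derivation !raddfB. Qed.

Lemma derivationN x f : D x (- f) = - D x f.
Proof. by rewrite /derivation !raddfN. Qed.

Lemma derivation0 x : D x 0 = 0.
Proof. by rewrite /derivation !raddf0. Qed.

Lemma derivationM x f g : D x (f * g) = D x f * g + f * D x g.
Proof. by rewrite /derivation rmorphM vfieldM /= !pullVK. Qed.

Lemma derivation_pull x f : D x (sg f) = x f.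
Proof. by rewrite /derivation pullK. Qed.

(** On derivations [Ad] is conjugation by the pullback along [phi], hence compatible with
    commutators. *)
Lemma derivation_Ad x f : D (Ad x) (sg f) = sg (D x f).
Proof. by rewrite derivation_pull. Qed.

Lemma derivation_Cst x r : D x (Cst M r) = 0.
Proof.
(* The twisted Leibniz rule at 1 = 1 * 1 gives [x 1 = x 1 + x 1]. *)
have x1 : x 1 = 0.
  apply: (addrI (x 1)).
  by rewrite addr0 -[in RHS](mulr1 1) vfieldM rmorph1 mulr1 mul1r.
rewrite /derivation pull_Cst -[Cst M r]mulr1 -[_ * 1]addr0 vfieldP x1 mulr0.
by rewrite raddf0 addr0.
Qed.

Lemma derivation_inj x y : (forall f, D x f = D y f) -> x = y.
Proof.
by move=> xy; apply/val_inj/funext => f; have := xy (sg f); rewrite !derivation_pull.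
Qed.

Lemma derivationDl x y f : D (x + y) f = D x f + D y f.
Proof. by []. Qed.

Lemma derivationNl x f : D (- x) f = - D x f.
Proof. by []. Qed.

Lemma derivationZl g x f : D (g *: x) f = g * D x f.
Proof. by []. Qed.

Definition derivationE := (derivationDl, derivationNl, derivationZl,
  derivationD, derivationN, derivationM).

End Derivation.

(** * Hom-Lie algebroids as twists of Lie algebroids with an automorphism *)

Section Twist.
Variables (R : realType) (n : nat) (M : manifold R n) (phi : diffeo M).
Local Notation C := (Cinfty M).
Local Notation D := (@derivation R n M phi).

(* An ordinary Lie algebroid (a Lie-Rinehart algebra over [C]) on which
   [hb_map] acts by automorphisms covering [phi]. *)
Record equivariant_lie_algebroid (A : hom_bundle phi) (b : A -> A -> A)
    (a : A -> vfield phi) : Prop := {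
  lieN : forall x y, b x y = - b y x;
  lieD : forall x y z, b x (y + z) = b x y + b x z;
  lieZ : forall x f y, b x (f *: y) = f *: b x y + D (a x) f *: y;
  lie_jacobi : forall x y z, b x (b y z) + b y (b z x) + b z (b x y) = 0;
  anchor_linear : forall f x y, a (f *: x + y) = f *: a x + a y;
  anchor_lie : forall x y f,
    D (a (b x y)) f = D (a x) (D (a y) f) - D (a y) (D (a x) f);
  hb_map_lie : forall x y, hb_map (b x y) = b (hb_map x) (hb_map y);
  anchor_hb_map : forall x, a (hb_map x) = Ad (a x) }.

(* Yau's twisting principle. *)
Lemma twist_hom_lie_algebroid (A : hom_bundle phi) (b : A -> A -> A) a :
  equivariant_lie_algebroid b a ->
  hom_lie_algebroid (fun x y => hb_map (b x y)) a.
Proof.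
case=> bN bD bZ bJ aL aB hB aH.
have hN (x : A) : hb_map (- x) = - hb_map x.
  by rewrite -scaleN1r hb_mapZ rmorphN1 scaleN1r.
have h0 : hb_map (0 : A) = 0.
  by apply: (addrI (hb_map (0 : A))); rewrite -hb_mapD !addr0.
split.
- split.
  (* Linearity over the reals is the Leibniz rule for constant functions, which derivations kill. *)
  + by move=> x r y z; rewrite bD bZ derivation_Cst scale0r addr0 hb_mapD hb_mapZ pull_Cst.
  + by move=> x y; rewrite bN hN.
  + by move=> r x y; rewrite hb_mapD hb_mapZ pull_Cst.
  + by move=> x y; rewrite hB.
  (* The Hom-Jacobi sum is the image of the ordinary Jacobi sum under the square of [hb_map]. *)
  + by move=> x y z; rewrite -!hB -!hb_mapD bJ !h0.
- exact: aL.
- move=> x y f; rewrite bZ hb_mapD !hb_mapZ aH.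
  by rewrite -[in RHS](derivation_pull (Ad _)) derivation_Ad.
- split=> [f r x y|x r f g|r f g|x f|x y f].
  + by rewrite aL.
  + exact: vfieldP.
  + exact: pull_linear.
  + by rewrite aH /= pullK.
  + rewrite !aH -!(derivation_pull (Ad _)) !derivation_Ad.
    by rewrite -![a _ f]derivation_pull aB raddfB.
Qed.
End Twist.

(** * The commutator bracket of derivations and its pairing with forms *)

Section TangentLie.
Variables (R : realType) (n : nat) (M : manifold R n) (phi : diffeo M).
Local Notation C := (Cinfty M).
Local Notation D := (@derivation R n M phi).
Local Notation T := (tangent phi).
Implicit Types (x y z : T) (f g : C) (xi eta zeta : dual T).

(** Removing the outer twist leaves the commutator of the derivations [D x] and [D y], as
    [derivation_lie] shows. *)
Definition lie_bracket x y : T := Ad_inv (tangent_bracket x y).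

Lemma tangent_bracketE : @tangent_bracket R n M phi = fun x y => hb_map (lie_bracket x y).
Proof. by apply/funext => x; apply/funext => y; rewrite /lie_bracket /= Ad_invK. Qed.

Lemma derivation_lie x y f : D (lie_bracket x y) f = D x (D y f) - D y (D x f).
Proof. by rewrite /derivation /= raddfB /= !pullVK. Qed.

Lemma tangent_equivariant_lie_algebroid :
  equivariant_lie_algebroid lie_bracket (@tangent_anchor R n M phi).
Proof.
split=> //; rewrite /tangent_anchor.
- by move=> x y; apply/derivation_inj => f; rewrite derivationNl !derivation_lie opprB.
- move=> x y z; apply/derivation_inj => f.
  by rewrite derivationDl !derivation_lie !derivationDl derivationD; ring.
- move=> x f y; apply/derivation_inj => g.
  by rewrite !derivationE !derivation_lie !derivationE; ring.
- move=> x y z; apply/derivation_inj => f.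
  rewrite !derivationDl !derivation_lie !derivationB -[RHS]/(0 : C); ring.
- exact: derivation_lie.
- move=> x y; apply/derivation_inj => f.
  rewrite -[f](pullVK phi) -[hb_map (lie_bracket x y)]/(Ad (lie_bracket x y)).
  rewrite -[hb_map x]/(Ad x) -[hb_map y]/(Ad y) derivation_Ad !derivation_lie.
  by rewrite !derivation_Ad raddfB.
Qed.

Lemma lie_bracketN x y : lie_bracket x y = - lie_bracket y x.
Proof. exact: lieN tangent_equivariant_lie_algebroid _ _. Qed.

Lemma lie_bracketDr x y z : lie_bracket x (y + z) = lie_bracket x y + lie_bracket x z.
Proof. exact: lieD tangent_equivariant_lie_algebroid _ _ _. Qed.

Lemma lie_bracketZr x f y : lie_bracket x (f *: y) = f *: lie_bracket x y + D x f *: y.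
Proof. exact: lieZ tangent_equivariant_lie_algebroid _ _ _. Qed.

Lemma lie_bracketDl x y z : lie_bracket (x + y) z = lie_bracket x z + lie_bracket y z.
Proof. by rewrite lie_bracketN lie_bracketDr opprD -!lie_bracketN. Qed.

Lemma lie_bracketZl x f y : lie_bracket (f *: x) y = f *: lie_bracket x y - D y f *: x.
Proof. by rewrite lie_bracketN lie_bracketZr opprD -scalerN -lie_bracketN. Qed.

Lemma lie_bracketNr x y : lie_bracket x (- y) = - lie_bracket x y.
Proof.
apply/eqP; rewrite -addr_eq0 -lie_bracketDr addNr; apply/eqP.
by apply: (addrI (lie_bracket x 0)); rewrite -lie_bracketDr !addr0.
Qed.

Lemma lie_bracketNl x y : lie_bracket (- x) y = - lie_bracket x y.
Proof. by rewrite lie_bracketN lie_bracketNr -lie_bracketN. Qed.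

Lemma Ad_lie_bracket x y : Ad (lie_bracket x y) = lie_bracket (Ad x) (Ad y).
Proof. exact: hb_map_lie tangent_equivariant_lie_algebroid _ _. Qed.

Lemma lie_bracket_jacobi x y z :
  lie_bracket (lie_bracket x y) z
  = lie_bracket x (lie_bracket y z) - lie_bracket y (lie_bracket x z).
Proof.
apply/derivation_inj => f.
by rewrite derivationDl derivationNl !derivation_lie !derivationB; ring.
Qed.

Lemma dualD xi x y : xi (x + y) = xi x + xi y.
Proof. exact: (raddfD xi). Qed.
Lemma dualN xi x : xi (- x) = - xi x.
Proof. exact: (raddfN xi). Qed.
Lemma dualZ xi f x : xi (f *: x) = f * xi x.
Proof. exact: (linearZ_LR xi). Qed.

Definition multilinearE :=
  (dualD, dualN, dualZ, lie_bracketDr, lie_bracketDl, lie_bracketNr,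
   lie_bracketNl, lie_bracketZr, lie_bracketZl, derivationE).

(** The equivariance of the pairing, from which that of the Koszul bracket and of the wedge products
    is deduced. *)
Lemma dagger_Ad xi x : dagger xi (Ad x : T) = pull phi (xi x).
Proof. by rewrite /= AdK. Qed.

Lemma dagger_invE xi x : dagger_inv xi x = pull (diffeo_inv phi) (xi (Ad x)).
Proof. by []. Qed.

Lemma dual_addE xi eta x : (xi + eta) x = xi x + eta x. Proof. by []. Qed.
Lemma dual_oppE xi x : (- xi) x = - xi x. Proof. by []. Qed.
Lemma dual_scaleE f xi x : (f *: xi) x = f * xi x. Proof. by []. Qed.

Lemma dual_inj xi eta : (forall x, xi x = eta x) -> xi = eta.
Proof. by move=> e; apply/val_inj/funext. Qed.

(* The differential of [f] for the untwisted bracket. *)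
Definition grad f : dual T := exact_form phi (pull (diffeo_inv phi) f).

(** With [derivation_inj], this reduces an equality of vector fields to that of their pairings with
    all [grad f]. *)
Lemma gradE f x : grad f x = D x f.
Proof. exact: exact_formE. Qed.

Lemma exact_form_grad f : exact_form phi f = grad (pull phi f).
Proof. by rewrite /grad pullK. Qed.

Lemma dagger_grad f : dagger (grad f) = exact_form phi f.
Proof.
apply/dual_inj => x.
rewrite -[x]Ad_invK dagger_Ad gradE exact_formE -derivation_Ad derivation_pull.
by rewrite Ad_invK.
Qed.

End TangentLie.

(** * The Koszul bracket and the sharp map of a bivector *)

Section Bivector.
Variables (R : realType) (n : nat) (M : manifold R n) (phi : diffeo M).
Local Notation C := (Cinfty M).
Local Notation D := (@derivation R n M phi).
Local Notation T := (tangent phi).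
Local Notation sgV := (pull (diffeo_inv phi)).
Implicit Types (x y z : T) (f g : C) (xi eta zeta : dual T).

(** The sharp map of the decomposable bivector given by [x] and [y], in this order. *)
Definition wedge_sharp x y xi : T := xi x *: y - xi y *: x.

(** Without its twists, the Lie derivative of a form is the ordinary one of Cartan calculus. *)
Lemma pull_inv_lie x xi y : sgV (lie x xi (Ad y)) = D x (xi y) - xi (lie_bracket x y).
Proof.
rewrite -[lie x xi _]/(Ad x (xi (Ad_inv (Ad y)))
  - dagger xi (tangent_bracket x (Ad_inv (Ad y)))) AdK raddfB.
by rewrite -[tangent_bracket x y]Ad_invK dagger_Ad /= !pullK.
Qed.

Variable pi : multivector T 2.

(* The untwisted cotangent bracket. *)
Definition koszul xi eta : dual T := dagger_inv (cotangent_bracket pi xi eta).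

Lemma koszulE xi eta x :
  koszul xi eta x = D (sharp pi xi) (eta x) - eta (lie_bracket (sharp pi xi) x)
    - (D (sharp pi eta) (xi x) - xi (lie_bracket (sharp pi eta) x))
    - D x (pi (pair2 xi eta)).
Proof.
have pullB f g h : sgV (f - g - h) = sgV f - sgV g - sgV h by rewrite !raddfB.
rewrite /koszul dagger_invE /cotangent_bracket !dual_addE !dual_oppE pullB.
by rewrite !pull_inv_lie exact_formE -derivation_pull derivation_Ad pullK.
Qed.

Variables (r : nat) (v : 'I_r -> 'I_2 -> T).
Hypothesis piE : pi =1 sum_wedge v.

Lemma sharp_sum xi : sharp pi xi = \sum_s wedge_sharp (v s ord0) (v s ord_max) xi.
Proof.
apply/val_inj/funext => f; rewrite [RHS]vfield_sum [LHS]/= piE sum_wedge2.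
by apply: eq_bigr => s _; rewrite vfieldZB !exact_formE.
Qed.

Lemma sharpN xi eta : eta (sharp pi xi) = - xi (sharp pi eta).
Proof.
rewrite !(sharpE _ _ piE) !piE !sum_wedge2 -sumrN.
by apply: eq_bigr => s _; rewrite opprB [X in _ - X]mulrC [X in X - _]mulrC.
Qed.

(** Skew-symmetry turns the argument of [sharp] into the form that is evaluated, where linearity is
    immediate. *)
Lemma sharp_linear f xi eta : sharp pi (f *: xi + eta) = f *: sharp pi xi + sharp pi eta.
Proof.
apply/derivation_inj => g; rewrite derivationDl derivationZl -!gradE.
by rewrite sharpN dual_addE dual_scaleE opprD -mulrN -!sharpN.
Qed.

Lemma sharpD xi eta : sharp pi (xi + eta) = sharp pi xi + sharp pi eta.
Proof. by rewrite -[xi]scale1r sharp_linear !scale1r. Qed.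

Lemma sharp0 : sharp pi 0 = 0.
Proof. by apply: (addrI (sharp pi 0)); rewrite -sharpD !addr0. Qed.

Lemma sharpZ f xi : sharp pi (f *: xi) = f *: sharp pi xi.
Proof. by rewrite -[f *: xi]addr0 sharp_linear sharp0 addr0. Qed.

End Bivector.

(** * The Schouten bracket of bivectors in terms of their sharp maps *)

Section SchoutenForm.
Variables (R : realType) (n : nat) (M : manifold R n) (phi : diffeo M).
Local Notation C := (Cinfty M).
Local Notation D := (@derivation R n M phi).
Local Notation T := (tangent phi).
Variables (xi eta zeta : dual T).
Implicit Types P Q : dual T -> T.

(* If P and Q are the sharp maps of two bivectors, then the value of the Schouten
   bracket of these at [(xi, eta, zeta)] is
   [schouten_half P Q + schouten_half Q P]. *)
Definition schouten_half P Q : C :=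
  zeta (lie_bracket (P xi) (Q eta)) + xi (lie_bracket (P eta) (Q zeta))
  + eta (lie_bracket (P zeta) (Q xi))
  + D (P xi) (eta (Q zeta)) + D (P eta) (zeta (Q xi)) + D (P zeta) (xi (Q eta)).

Lemma schouten_halfDl P P' Q :
  schouten_half (P + P') Q = schouten_half P Q + schouten_half P' Q.
Proof. by rewrite /schouten_half !fctE !multilinearE; ring. Qed.

Lemma schouten_halfDr P Q Q' :
  schouten_half P (Q + Q') = schouten_half P Q + schouten_half P Q'.
Proof. by rewrite /schouten_half !fctE !multilinearE; ring. Qed.

Lemma schouten_half_sum r r' (P : 'I_r -> dual T -> T) (Q : 'I_r' -> dual T -> T) :
  schouten_half (\sum_s P s) (\sum_t Q t) = \sum_s \sum_t schouten_half (P s) (Q t).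
Proof.
have h0l Q0 : schouten_half 0 Q0 = 0.
  by apply: (addrI (schouten_half 0 Q0)); rewrite -schouten_halfDl !addr0.
have h0r P0 : schouten_half P0 0 = 0.
  by apply: (addrI (schouten_half P0 0)); rewrite -schouten_halfDr !addr0.
rewrite (big_morph (schouten_half^~ _) (fun P P' => schouten_halfDl P P' _) (h0l _)).
apply: eq_bigr => s _.
by rewrite (big_morph (schouten_half _) (schouten_halfDr _) (h0r _)).
Qed.

(** The 3 by 3 determinant of the pairings, expanded along the row of [xi]. *)
Definition wedge3 (x y z : T) : C :=
    xi x * (eta y * zeta z - eta z * zeta y)
  - xi y * (eta x * zeta z - eta z * zeta x)
  + xi z * (eta x * zeta y - eta y * zeta x).

Lemma dual_lie_bracketZ (om : dual T) (f g : C) (a b : T) :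
  om (lie_bracket (f *: a) (g *: b))
  = f * g * om (lie_bracket a b) + f * D a g * om b - g * D b f * om a.
Proof.
rewrite lie_bracketZl lie_bracketZr !(derivationZl, dualD, dualN, dualZ, scalerDr); ring.
Qed.

Lemma dual_lie_bracket_wedge (om : dual T) (al be : dual T) (a b c d : T) :
  om (lie_bracket (wedge_sharp a b al) (wedge_sharp c d be))
  = al a * be c * om (lie_bracket b d) + al a * D b (be c) * om d - be c * D d (al a) * om b
  - (al a * be d * om (lie_bracket b c) + al a * D b (be d) * om c - be d * D c (al a) * om b)
  - (al b * be c * om (lie_bracket a d) + al b * D a (be c) * om d - be c * D d (al b) * om a)
  + (al b * be d * om (lie_bracket a c) + al b * D a (be d) * om c - be d * D c (al b) * om a).
Proof.
rewrite /wedge_sharp.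
rewrite lie_bracketDl lie_bracketNl 2!lie_bracketDr 2!lie_bracketNr.
rewrite dualD dualN 2!dualD 2!dualN 4!dual_lie_bracketZ; ring.
Qed.

Lemma derivation_wedge (al be ga : dual T) (a b c d : T) :
  D (wedge_sharp a b al) (be (wedge_sharp c d ga))
  = al a * (D b (ga c) * be d + ga c * D b (be d) - D b (ga d) * be c - ga d * D b (be c))
  - al b * (D a (ga c) * be d + ga c * D a (be d) - D a (ga d) * be c - ga d * D a (be c)).
Proof.
rewrite /wedge_sharp dualD dualN !dualZ derivationDl derivationNl !derivationZl.
by rewrite !derivationB !derivationM; ring.
Qed.

(** The derivatives of pairings that remain in each half cancel in the sum. Only the brackets of the
    factors are left, with the signs of the Schouten bracket of two decomposable bivectors. *)
Lemma schouten_half_wedge (a b c d : T) :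
  schouten_half (wedge_sharp a b) (wedge_sharp c d)
  + schouten_half (wedge_sharp c d) (wedge_sharp a b)
  = wedge3 (lie_bracket a c) b d - wedge3 (lie_bracket a d) b c
  - wedge3 (lie_bracket b c) a d + wedge3 (lie_bracket b d) a c.
Proof.
rewrite /schouten_half /wedge3.
rewrite 6!dual_lie_bracket_wedge 6!derivation_wedge.
rewrite (lie_bracketN c a) (lie_bracketN c b) (lie_bracketN d a) (lie_bracketN d b) !dualN.
(* [ring] is too slow unless its atoms are variables. *)
repeat match goal with |- context [D ?x ?f] => generalize (D x f); intro end.
repeat match goal with |- context [dual_val ?x ?f] => generalize (dual_val x f); intro end.
ring.
Qed.
End SchoutenForm.

(** * Expansion of the Schouten bracket of decomposable bivectors by determinants *)

Lemma det_mx3 (K : comPzRingType) (A : 'M[K]_3) :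
  let i1 := lift ord0 ord0 in let i2 := lift ord0 (lift ord0 ord0) in
  \det A = A ord0 ord0 * (A i1 i1 * A i2 i2 - A i1 i2 * A i2 i1)
         - A ord0 i1 * (A i1 ord0 * A i2 i2 - A i1 i2 * A i2 ord0)
         + A ord0 i2 * (A i1 ord0 * A i2 i1 - A i1 i1 * A i2 ord0).
Proof.
move=> i1 i2.
have lift1 : (lift i1 ord0 = ord0) * (lift i1 ord_max = i2) by split; apply/val_inj.
have lift2 : (lift i2 ord0 = ord0) * (lift i2 ord_max = i1) by split; apply/val_inj.
have lift0 : lift ord0 (ord_max : 'I_2) = i2 by apply/val_inj.
rewrite (expand_det_row _ ord0) !big_ord_recl big_ord0 /cofactor !det_mx2 !mxE.
rewrite -/i1 -/i2 lift0 !lift1 !lift2 /= /bump /= !addn0 expr0 expr1 sqrrN expr1n.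
ring.
Qed.

Section SchoutenTerm.
Variables (R : realType) (n : nat) (M : manifold R n) (phi : diffeo M).
Variables (A : hom_bundle phi) (br : A -> A -> A) (p q : nat).
Variables (x : 'I_p.+1 -> A) (y : 'I_q.+1 -> A) (i : 'I_p.+1) (j : 'I_q.+1).

Lemma schouten_term_bracket : schouten_term br x y i j ord0 = br (x i) (y j).
Proof.
have -> : ord0 = unsplit (inl ord0) :> 'I_(1 + (p + q)) by apply/val_inj.
by rewrite /schouten_term unsplitK.
Qed.

Lemma schouten_term_left u :
  schouten_term br x y i j (lift ord0 (lshift q u)) = hb_map (x (lift i u)).
Proof.
have -> : lift ord0 (lshift q u) = unsplit (inr (unsplit (inl u))) :> 'I_(1 + (p + q)).
  exact/val_inj.
by rewrite /schouten_term !unsplitK.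
Qed.

Lemma schouten_term_right u :
  schouten_term br x y i j (lift ord0 (rshift p u)) = hb_map (y (lift j u)).
Proof.
have -> : lift ord0 (rshift p u) = unsplit (inr (unsplit (inr u))) :> 'I_(1 + (p + q)).
  exact/val_inj.
by rewrite /schouten_term !unsplitK.
Qed.
End SchoutenTerm.

Section SchoutenTangent.
Variables (R : realType) (n : nat) (M : manifold R n) (phi : diffeo M).
Local Notation T := (tangent phi).
Local Notation sg := (pull phi).

Lemma wedge3_Ad (xi eta zeta : dual T) (a b c : T) :
  wedge3 (dagger xi) (dagger eta) (dagger zeta) (Ad a) (Ad b) (Ad c)
  = sg (wedge3 xi eta zeta a b c).
Proof. by rewrite /wedge3 9!dagger_Ad rmorphD rmorphB 3!rmorphM 3!rmorphB 6!rmorphM. Qed.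

Lemma wedge_prod3 (x : 'I_3 -> T) (X : 'I_3 -> dual T) :
  let i1 := lift ord0 ord0 in let i2 := lift ord0 (lift ord0 ord0) in
  wedge_prod x X = wedge3 (X ord0) (X i1) (X i2) (x ord0) (x i1) (x i2).
Proof. by rewrite /wedge_prod det_mx3 !mxE. Qed.

Lemma lift_ord2 : (lift ord0 ord0 = ord_max :> 'I_2) * (lift ord_max ord0 = ord0 :> 'I_2).
Proof. by split; apply/val_inj. Qed.

Lemma sum_ord2 (V : nmodType) (F : 'I_2 -> V) : \sum_i F i = F ord0 + F ord_max.
Proof. by rewrite big_ord_recl big_ord1; congr (_ + F _); apply/val_inj. Qed.

Lemma schouten_wedge11 (x y : 'I_2 -> T) (X : 'I_3 -> dual T) :
  let W := wedge3 (X ord0) (X (lift ord0 ord0)) (X (lift ord0 (lift ord0 ord0))) in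
  let br := @tangent_bracket R n M phi in
  schouten_wedge (p := 1) (q := 1) br x y X
  = W (br (x ord0) (y ord0)) (Ad (x ord_max)) (Ad (y ord_max))
  - W (br (x ord0) (y ord_max)) (Ad (x ord_max)) (Ad (y ord0))
  - W (br (x ord_max) (y ord0)) (Ad (x ord0)) (Ad (y ord_max))
  + W (br (x ord_max) (y ord_max)) (Ad (x ord0)) (Ad (y ord0)).
Proof.
move=> W br.
have wE i j : wedge_prod (schouten_term (p := 1) (q := 1) br x y i j) X
    = W (br (x i) (y j)) (Ad (x (lift i ord0))) (Ad (y (lift j ord0))).
  (* Indices 1 and 2 are put in the form in which [schouten_term] splits them: the remaining factor
     of [x], then that of [y]. *)
  have i1E : lift ord0 ord0 = lift ord0 (lshift 1 ord0) :> 'I_(1 + (1 + 1)).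
    exact/val_inj.
  have i2E : lift ord0 (lift ord0 ord0) = lift ord0 (rshift 1 ord0) :> 'I_(1 + (1 + 1)).
    exact/val_inj.
  rewrite (wedge_prod3 (schouten_term (p := 1) (q := 1) br x y i j)).
  rewrite schouten_term_bracket [X in wedge3 _ _ _ _ (schouten_term _ _ _ _ _ X) _]i1E.
  rewrite schouten_term_left [X in schouten_term _ _ _ _ _ X]i2E.
  by rewrite schouten_term_right.
rewrite /schouten_wedge sum_ord2 !sum_ord2 !wE !lift_ord2 /=.
rewrite expr0 expr1 sqrrN expr1n !mul1r !mulN1r; ring.
Qed.
End SchoutenTangent.

(** * The cotangent Lie algebroid of a Hom-Poisson structure *)

Section HomPoisson.
Variables (R : realType) (n : nat) (M : manifold R n) (phi : diffeo M).
Local Notation C := (Cinfty M).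
Local Notation D := (@derivation R n M phi).
Local Notation T := (tangent phi).
Local Notation sg := (pull phi).
Variable pi : multivector T 2.
Local Notation "xi ^#" := (sharp pi xi) (at level 2, format "xi ^#").
Hypothesis poisson : hom_poisson pi.
Implicit Types (x y z : T) (f g : C) (xi eta zeta : dual T).

Lemma Cinfty_double_eq0 f : f + f = 0 -> f = 0.
Proof.
move=> ff; apply/val_inj/funext => p.
have /eqP := congr1 (fun h : C => h p) ff.
by rewrite -[(f + f) p]/(f p + f p) -mulr2n mulrn_eq0 /= => /eqP.
Qed.

(** Twice the left-hand side is, up to the twist, the Schouten bracket of [pi] with itself, and
    real-valued functions have no 2-torsion. *)
Lemma poisson_schouten_half xi eta zeta :
  schouten_half xi eta zeta (sharp pi) (sharp pi) = 0.
Proof.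
have [[r [v [r' [w [vE wE vw0]]]]] _] := poisson.
have vP : sharp pi = \sum_s wedge_sharp (v s ord0) (v s ord_max).
  by apply/funext => al; rewrite (sharp_sum vE) fct_sumE.
have wP : sharp pi = \sum_s wedge_sharp (w s ord0) (w s ord_max).
  by apply/funext => al; rewrite (sharp_sum wE) fct_sumE.
(* The hypothesis supplies two decompositions of [pi] that may differ, so one copy is expanded along
   ([v], [w]) and the other along ([w], [v]). *)
apply: Cinfty_double_eq0; rewrite {1}vP {1}wP {1}wP {1}vP !schouten_half_sum.
rewrite [X in _ + X]exchange_big -big_split /=.
under eq_bigr => s _ do rewrite -big_split /=.
(* Evaluating the hypothesis at twisted forms makes all twists factor out as one pullback, which is
   injective. *)
pose X := [eta fun=> dagger zeta with ord0 |-> dagger xi,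
  lift ord0 ord0 |-> dagger eta] : 'I_3 -> dual T.
apply: (can_inj (pullK phi)); rewrite rmorph0 [RHS](vw0 X) rmorph_sum.
apply: eq_bigr => s _; rewrite rmorph_sum; apply: eq_bigr => t _.
rewrite schouten_half_wedge schouten_wedge11 tangent_bracketE.
by rewrite -![hb_map (lie_bracket _ _)]/(Ad (lie_bracket _ _)) 4!wedge3_Ad rmorphD 2!rmorphB.
Qed.

Lemma poisson_decomposition :
  exists r (v : 'I_r -> 'I_2 -> T), pi =1 sum_wedge v.
Proof. by have [[r [v [_ [_ [vE _ _]]]]] _] := poisson; exists r, v. Qed.

Lemma poisson_sharpN xi eta : eta xi^# = - xi eta^#.
Proof. by have [r [v /sharpN]] := poisson_decomposition; exact. Qed.

Lemma poisson_sharpE xi eta : pi (pair2 xi eta) = eta xi^#.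
Proof. by have [r [v /sharpE->]] := poisson_decomposition. Qed.

Lemma poisson_sharp_linear f xi eta : (f *: xi + eta)^# = f *: xi^# + eta^# :> T.
Proof. by have [r [v /sharp_linear]] := poisson_decomposition; exact. Qed.

Lemma poisson_sharpZ f xi : (f *: xi)^# = f *: xi^# :> T.
Proof. by have [r [v /sharpZ]] := poisson_decomposition; exact. Qed.

Lemma poisson_sharpD xi eta : (xi + eta)^# = xi^# + eta^# :> T.
Proof. by have [r [v /sharpD]] := poisson_decomposition; exact. Qed.

(** The invariance of [pi] provides a decomposition whose image under [Ad] is again one of [pi];
    each side is computed with one of the two. *)
Lemma poisson_dagger xi eta :
  pi (pair2 (dagger xi) (dagger eta)) = sg (pi (pair2 xi eta)).
Proof.
have [_ [r [v [vE wE]]]] := poisson.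
rewrite wE vE !sum_wedge2 rmorph_sum; apply: eq_bigr => s _.
rewrite -[LHS]/(dagger xi (Ad (v s ord0)) * dagger eta (Ad (v s ord_max))
  - dagger xi (Ad (v s ord_max)) * dagger eta (Ad (v s ord0))).
by rewrite 4!dagger_Ad rmorphB 2!rmorphM.
Qed.

Lemma sharp_dagger xi : (dagger xi)^# = Ad xi^# :> T.
Proof.
apply/derivation_inj => f; rewrite -[f](pullVK phi) derivation_Ad.
rewrite -!gradE -!poisson_sharpE -poisson_dagger dagger_grad.
by rewrite exact_form_grad.
Qed.

Lemma koszul_pairing xi eta x :
  koszul pi xi eta x = D xi^# (eta x) - eta (lie_bracket xi^# x)
    - (D eta^# (xi x) - xi (lie_bracket eta^# x)) - D x (eta xi^#).
Proof. by rewrite koszulE poisson_sharpE. Qed.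

(** Paired with [grad f], the left side minus the right side is the opposite of [schouten_half] at
    [xi], [eta], [grad f], which vanishes. *)
Lemma sharp_koszul xi eta : (koszul pi xi eta)^# = lie_bracket xi^# eta^# :> T.
Proof.
apply/derivation_inj => f; rewrite -!gradE; set zeta := grad phi f.
apply/eqP; rewrite -subr_eq0 -oppr_eq0 -(poisson_schouten_half xi eta zeta).
rewrite poisson_sharpN koszul_pairing /schouten_half.
rewrite (poisson_sharpN xi zeta) (poisson_sharpN xi eta) (lie_bracketN zeta^# xi^#) dualN.
by rewrite !derivationN; apply/eqP; ring.
Qed.

Lemma koszulN xi eta : koszul pi xi eta = - koszul pi eta xi.
Proof.
apply/dual_inj => x; rewrite dual_oppE !koszul_pairing (poisson_sharpN xi eta).
by rewrite derivationN; ring.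
Qed.

Lemma koszulD xi eta zeta : koszul pi xi (eta + zeta) = koszul pi xi eta + koszul pi xi zeta.
Proof.
apply/dual_inj => x; rewrite dual_addE !koszul_pairing !dual_addE poisson_sharpD.
by rewrite lie_bracketDl dualD 2!derivationD derivationDl; ring.
Qed.

Lemma koszulZ xi f eta :
  koszul pi xi (f *: eta) = f *: koszul pi xi eta + D xi^# f *: eta.
Proof.
apply/dual_inj => x; rewrite dual_addE !dual_scaleE !koszul_pairing !dual_scaleE poisson_sharpZ.
rewrite lie_bracketZl dualD dualN 2!dualZ 2!derivationM derivationZl.
by rewrite (poisson_sharpN xi eta) derivationN; ring.
Qed.

Lemma koszul_dagger xi eta : dagger (koszul pi xi eta) = koszul pi (dagger xi) (dagger eta).
Proof.
apply/dual_inj => x; rewrite -[x]Ad_invK dagger_Ad !koszul_pairing !sharp_dagger.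
rewrite -2!Ad_lie_bracket 5!dagger_Ad 3!derivation_Ad.
by rewrite 4!rmorphB.
Qed.

(** At [x], once [sharp_koszul] has removed the sharps of brackets, the Jacobi sum is the derivative
    along [x] of [schouten_half], hence of zero. *)
Lemma koszul_jacobi xi eta zeta :
  koszul pi xi (koszul pi eta zeta) + koszul pi eta (koszul pi zeta xi)
  + koszul pi zeta (koszul pi xi eta) = 0.
Proof.
apply/dual_inj => x; rewrite 2!dual_addE.
transitivity (D x (schouten_half xi eta zeta (sharp pi) (sharp pi))); last first.
  by rewrite poisson_schouten_half derivation0.
rewrite 3!(koszul_pairing _ (koszul _ _ _)) 3!sharp_koszul.
(* Skew-symmetry turns a bracket evaluated at a sharp into a form evaluated at the sharp of that
   bracket, so that [sharp_koszul] applies again. *)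
rewrite (poisson_sharpN xi) (poisson_sharpN eta) (poisson_sharpN zeta) 3!sharp_koszul.
rewrite 6!koszul_pairing 3!lie_bracket_jacobi /schouten_half.
rewrite (poisson_sharpN xi zeta) (poisson_sharpN xi eta) (poisson_sharpN eta zeta).
rewrite 6!derivation_lie 3!dualD 3!dualN 9!derivationB 5!derivationD 8!derivationN.
ring.
Qed.

End HomPoisson.

(** * Schouten brackets of bivectors with vector fields *)

Section Wedge2.
Variables (R : realType) (n : nat) (M : manifold R n) (phi : diffeo M).
Local Notation C := (Cinfty M).
Local Notation T := (tangent phi).

Definition wedge2 (xi eta : dual T) (a b : T) : C := xi a * eta b - xi b * eta a.

Lemma wedge2_Ad xi eta a b :
  wedge2 (dagger xi) (dagger eta) (Ad a) (Ad b) = pull phi (wedge2 xi eta a b).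
Proof. by rewrite /wedge2 4!dagger_Ad rmorphB 2!rmorphM. Qed.

Lemma wedge_prod2 (x : 'I_2 -> T) (X : 'I_2 -> dual T) :
  wedge_prod x X = wedge2 (X ord0) (X ord_max) (x ord0) (x ord_max).
Proof. by rewrite /wedge_prod det_mx2 !mxE. Qed.

Lemma schouten_wedge10 (x : 'I_2 -> T) (y : 'I_1 -> T) (X : 'I_2 -> dual T) :
  let W := wedge2 (X ord0) (X ord_max) in
  let br := @tangent_bracket R n M phi in
  schouten_wedge (p := 1) (q := 0) br x y X
  = W (br (x ord0) (y ord0)) (Ad (x ord_max)) - W (br (x ord_max) (y ord0)) (Ad (x ord0)).
Proof.
move=> W br.
have wE i : wedge_prod (schouten_term (p := 1) (q := 0) br x y i ord0) X
    = W (br (x i) (y ord0)) (Ad (x (lift i ord0))).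
  rewrite (wedge_prod2 (schouten_term (p := 1) (q := 0) br x y i ord0)).
  have maxE : ord_max = lift ord0 (lshift 0 ord0) :> 'I_(1 + (1 + 0)) by apply/val_inj.
  rewrite schouten_term_bracket [X in wedge2 _ _ _ (schouten_term _ _ _ _ _ X)]maxE.
  by rewrite schouten_term_left.
rewrite /schouten_wedge sum_ord2 !big_ord1 !wE !lift_ord2 /=.
by rewrite expr0 expr1 mul1r mulN1r.
Qed.

Lemma schouten_wedge01 (x : 'I_1 -> T) (y : 'I_2 -> T) (X : 'I_2 -> dual T) :
  let W := wedge2 (X ord0) (X ord_max) in
  let br := @tangent_bracket R n M phi in
  schouten_wedge (p := 0) (q := 1) br x y X
  = W (br (x ord0) (y ord0)) (Ad (y ord_max)) - W (br (x ord0) (y ord_max)) (Ad (y ord0)).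
Proof.
move=> W br.
have wE j : wedge_prod (schouten_term (p := 0) (q := 1) br x y ord0 j) X
    = W (br (x ord0) (y j)) (Ad (y (lift j ord0))).
  rewrite (wedge_prod2 (schouten_term (p := 0) (q := 1) br x y ord0 j)).
  have maxE : ord_max = lift ord0 (rshift 0 ord0) :> 'I_(1 + (0 + 1)) by apply/val_inj.
  rewrite schouten_term_bracket [X in wedge2 _ _ _ (schouten_term _ _ _ _ _ X)]maxE.
  by rewrite schouten_term_right.
rewrite /schouten_wedge big_ord1 sum_ord2 !wE !lift_ord2 /=.
by rewrite expr0 expr1 mul1r mulN1r.
Qed.

Definition fun_cat (U : Type) r r' (v : 'I_r -> U) (w : 'I_r' -> U) (s : 'I_(r + r')) : U :=
  match fintype.split s with inl t => v t | inr t => w t end.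

Lemma sum_fun_cat (U : Type) (V : nmodType) (F : U -> V) r r' (v : 'I_r -> U) (w : 'I_r' -> U) :
  \sum_s F (fun_cat v w s) = \sum_s F (v s) + \sum_s F (w s).
Proof.
rewrite big_split_ord; congr (_ + _); apply: eq_bigr => s _; congr F; rewrite /fun_cat.
  by rewrite -[lshift _ _]/(unsplit (inl s)) unsplitK.
by rewrite -[rshift _ _]/(unsplit (inr s)) unsplitK.
Qed.

Lemma lie_bracket_suml r (u : 'I_r -> T) z :
  lie_bracket (\sum_s u s) z = \sum_s lie_bracket (u s) z.
Proof.
apply: (big_ind2 (fun a b => lie_bracket a z = b)) => // [|a b a' b' <- <-].
  by apply: (addrI (lie_bracket 0 z)); rewrite -lie_bracketDl !addr0.
by rewrite lie_bracketDl.
Qed.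

Lemma multivector1_wedge (x : T) : multivector1 x =1 sum_wedge (fun _ : 'I_1 => fun=> x).
Proof. by move=> X; rewrite /sum_wedge big_ord1 /wedge_prod det_mx11 mxE. Qed.

End Wedge2.

(** * The differential of the cotangent algebroid and the compatibility condition *)

Section Compatibility.
Variables (R : realType) (n : nat) (M : manifold R n) (phi : diffeo M).
Local Notation C := (Cinfty M).
Local Notation D := (@derivation R n M phi).
Local Notation T := (tangent phi).
Local Notation sg := (pull phi).
Variable pi : multivector T 2.
Local Notation "xi ^#" := (sharp pi xi) (at level 2, format "xi ^#").
Hypothesis poisson : hom_poisson pi.
Implicit Types (x y z : T) (f g : C) (xi eta zeta : dual T).

Lemma cotangent_bracketE :
  cotangent_bracket pi = fun xi eta => @hb_map _ _ _ _ (dual_bundle T) (koszul pi xi eta).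
Proof. by apply/funext => xi; apply/funext => eta; exact/esym/dagger_invK. Qed.

Lemma cotangent_equivariant_lie_algebroid :
  @equivariant_lie_algebroid _ _ _ _ (dual_bundle T) (koszul pi) (sharp pi).
Proof.
split.
- exact: koszulN.
- exact: koszulD.
- exact: koszulZ.
- exact: koszul_jacobi.
- exact: poisson_sharp_linear.
- by move=> xi eta f; rewrite sharp_koszul // derivation_lie.
- exact: koszul_dagger.
- exact: sharp_dagger.
Qed.

(* The untwisted d_* of [z], which is minus the Lie derivative of [pi] along [z]. *)
Definition coboundary z xi eta : C :=
  eta (lie_bracket xi^# z) - xi (lie_bracket eta^# z) + D z (eta xi^#).

Local Notation dstar := (dstar (cotangent_bracket pi) (sharp pi)).

Lemma dstarE x X : dstar (multivector1 x) X = coboundary (Ad x) (X ord0) (X ord_max).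
Proof.
rewrite /Defs.dstar /differential sum_ord2.
(* The only pair of indices [i < j] is (0, 1), with sign -1. *)
rewrite sum_ord2 (big_pred1 ord_max) => [|j]; last first.
  by case: j => [[|[|j]] Hj].
rewrite big1 => [|j]; last by case: j => [[|[|j]] Hj].
rewrite addr0 expr0 mul1r expr1 !mulN1r.
rewrite -[dagger_form _ _]/(sg (dagger_inv
  (cotangent_bracket pi (dagger_inv (X ord0)) (dagger_inv (X ord_max))) x)).
rewrite cotangent_bracketE -[hb_map _]/(dagger _) koszul_dagger // !dagger_invK.
rewrite dagger_invE pullVK koszul_pairing // /multivector1 !lift_ord2.
rewrite -[(X ord0)^# _]/(D (X ord0)^# (X ord_max (Ad x))).
rewrite -[(X ord_max)^# _]/(D (X ord_max)^# (X ord0 (Ad x))) /coboundary.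
ring.
Qed.

Lemma coboundary_Ad z xi eta :
  coboundary (Ad z) (dagger xi) (dagger eta) = sg (coboundary z xi eta).
Proof.
rewrite /coboundary !sharp_dagger // -!Ad_lie_bracket !dagger_Ad derivation_Ad.
by rewrite rmorphD rmorphB.
Qed.

Section Decomposition.
Variables (r : nat) (v : 'I_r -> 'I_2 -> T).
Hypothesis piE : pi =1 sum_wedge v.

(** The Leibniz rule for the Lie derivative: the term [D z (eta xi^#)] cancels the derivatives of
    the coefficients of [sharp]. *)
Lemma coboundary_sum z xi eta :
  coboundary z xi eta =
  \sum_s (wedge2 xi eta (lie_bracket (v s ord0) z) (v s ord_max)
         + wedge2 xi eta (v s ord0) (lie_bracket (v s ord_max) z)).
Proof.
rewrite /coboundary !(sharp_sum piE) !lie_bracket_suml !dual_sum.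
rewrite [X in D z X](_ : _ = \sum_s wedge2 xi eta (v s ord0) (v s ord_max)); last first.
  by apply: eq_bigr => s _; rewrite /wedge_sharp /wedge2 dualD dualN !dualZ.
have -> (F : 'I_r -> C) : D z (\sum_s F s) = \sum_s D z (F s).
  exact: (big_morph _ (derivationD z) (derivation0 z)).
rewrite -sumrB -big_split; apply: eq_bigr => s _ /=.
rewrite /wedge2 /wedge_sharp 2!lie_bracketDl 2!lie_bracketNl 4!lie_bracketZl.
rewrite !(dualD, dualN, dualZ) derivationB 2!derivationM.
ring.
Qed.

(** The relation [schouten] needs its arguments as explicit sums of wedge products; the Leibniz rule
    doubles the number of terms. *)
Definition coboundary_decomposition z : 'I_(r + r) -> 'I_2 -> T :=
  fun_cat (fun s => pair2 (lie_bracket (v s ord0) z) (v s ord_max))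
          (fun s => pair2 (v s ord0) (lie_bracket (v s ord_max) z)).

Lemma dstar_decomposition x :
  dstar (multivector1 x) =1 sum_wedge (coboundary_decomposition (Ad x)).
Proof.
move=> X; rewrite dstarE coboundary_sum /sum_wedge.
rewrite (sum_fun_cat (fun u => wedge_prod u X)) -big_split.
by apply: eq_bigr => s _; rewrite !wedge_prod2.
Qed.

(** In the sum of the two brackets, the terms in which [Ad x] and [Ad y] act on different factors
    cancel. Where both act on the same factor, the Jacobi identity gives the action of their
    bracket. *)
Lemma dstar_compatibility x y :
  exists S1 S2 : ('I_2 -> dual T) -> C,
    [/\ schouten (p := 1) (q := 0) (@tangent_bracket R n M phi) (dstar (multivector1 x))
          (multivector1 (Ad y : T)) S1,
        schouten (p := 0) (q := 1) (@tangent_bracket R n M phi) (multivector1 (Ad x : T))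
          (dstar (multivector1 y)) S2 &
        dstar (multivector1 (tangent_bracket x y)) =1 (fun X => S1 X + S2 X)].
Proof.
pose cst1 z : 'I_1 -> 'I_1 -> T := fun _ _ => z.
exists (fun X => \sum_s \sum_t schouten_wedge (p := 1) (q := 0) (@tangent_bracket R n M phi)
  (coboundary_decomposition (Ad x) s) (cst1 (Ad y) t) X).
exists (fun X => \sum_s \sum_t schouten_wedge (p := 0) (q := 1) (@tangent_bracket R n M phi)
  (cst1 (Ad x) s) (coboundary_decomposition (Ad y) t) X).
split.
- exists (r + r)%N, (coboundary_decomposition (Ad x)), 1%N, (cst1 (Ad y)).
  by split => //; [exact: dstar_decomposition | exact: multivector1_wedge].
- exists 1%N, (cst1 (Ad x)), (r + r)%N, (coboundary_decomposition (Ad y)).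
  by split => //; [exact: multivector1_wedge | exact: dstar_decomposition].
move=> X; set S1 := \sum_s _; set S2 := \sum_s _.
pose xi := dagger_inv (X ord0); pose eta := dagger_inv (X ord_max).
have X0 : X ord0 = dagger xi by rewrite dagger_invK.
have X1 : X ord_max = dagger eta by rewrite dagger_invK.
have S1E : S1 = \sum_s sg (
    wedge2 xi eta (lie_bracket (lie_bracket (v s ord0) (Ad x)) (Ad y)) (v s ord_max)
  - wedge2 xi eta (lie_bracket (v s ord_max) (Ad y)) (lie_bracket (v s ord0) (Ad x))
  + wedge2 xi eta (lie_bracket (v s ord0) (Ad y)) (lie_bracket (v s ord_max) (Ad x))
  - wedge2 xi eta (lie_bracket (lie_bracket (v s ord_max) (Ad x)) (Ad y)) (v s ord0)).
  rewrite /S1; under eq_bigr => s _ do rewrite big_ord1.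
  rewrite (sum_fun_cat (fun u => schouten_wedge (p := 1) (q := 0)
    (@tangent_bracket R n M phi) u (cst1 (Ad y) ord0) X)) -big_split.
  apply: eq_bigr => s _ /=; rewrite !schouten_wedge10 tangent_bracketE X0 X1.
  rewrite -![hb_map (lie_bracket _ _)]/(Ad (lie_bracket _ _)) 4!wedge2_Ad.
  by rewrite -2!rmorphB -rmorphD /= addrA.
have S2E : S2 = \sum_s sg (
    wedge2 xi eta (lie_bracket (Ad x) (lie_bracket (v s ord0) (Ad y))) (v s ord_max)
  - wedge2 xi eta (lie_bracket (Ad x) (v s ord_max)) (lie_bracket (v s ord0) (Ad y))
  + wedge2 xi eta (lie_bracket (Ad x) (v s ord0)) (lie_bracket (v s ord_max) (Ad y))
  - wedge2 xi eta (lie_bracket (Ad x) (lie_bracket (v s ord_max) (Ad y))) (v s ord0)).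
  rewrite /S2 big_ord1.
  rewrite (sum_fun_cat (fun u => schouten_wedge (p := 0) (q := 1)
    (@tangent_bracket R n M phi) (cst1 (Ad x) ord0) u X)) -big_split.
  apply: eq_bigr => s _ /=; rewrite !schouten_wedge01 tangent_bracketE X0 X1.
  rewrite -![hb_map (lie_bracket _ _)]/(Ad (lie_bracket _ _)) 4!wedge2_Ad.
  by rewrite -2!rmorphB -rmorphD /= addrA.
(* Of the two twists on the bracket of [x] and [y], one is pulled out as a pullback and the other
   moves onto [x] and [y]. *)
rewrite dstarE X0 X1 coboundary_Ad tangent_bracketE -[hb_map _]/(Ad _) Ad_lie_bracket.
rewrite coboundary_sum rmorph_sum S1E S2E -big_split; apply: eq_bigr => s _ /=.
rewrite -rmorphD; congr (pull phi _).
have derE c : lie_bracket c (lie_bracket (Ad x) (Ad y))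
    = lie_bracket (lie_bracket c (Ad x)) (Ad y) + lie_bracket (Ad x) (lie_bracket c (Ad y)).
  by rewrite [lie_bracket (lie_bracket c _) _]lie_bracket_jacobi subrK.
rewrite !derE (lie_bracketN (Ad x) (v s ord0)) (lie_bracketN (Ad x) (v s ord_max)).
rewrite /wedge2 4!dualD 4!dualN.
ring.
Qed.
End Decomposition.

End Compatibility.

Theorem proposition4p3 (R : realType) (n : nat) (M : manifold R n)
    (phi : diffeo M) (pi : multivector (tangent phi) 2) :
  hom_poisson pi ->
  hom_lie_bialgebroid (@tangent_bracket R n M phi) (@tangent_anchor R n M phi)
    (cotangent_bracket pi) (sharp pi).
Proof.
move=> poisson; split.
- rewrite tangent_bracketE.
  exact/twist_hom_lie_algebroid/tangent_equivariant_lie_algebroid.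
- rewrite cotangent_bracketE.
  exact: twist_hom_lie_algebroid (cotangent_equivariant_lie_algebroid poisson).
- move=> x y; have [r [v piE]] := poisson_decomposition poisson.
  exact: (dstar_compatibility poisson piE).
Qed.
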